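(* Let $n,\epsilon\in\mathbb{N}$ be positive integers. An opinion distribution $p\in\triangle^{n-1}\subset\mathbb{R}^n$ is a fixed point of the interactive Markov chain $p(t+1)=p(t)B^{\mathrm{DW}}(p(t),\epsilon)$ with Deffuant-Weisbuch transition matrix and discrete bound of confidence $\epsilon$ (that is, $p=pB^{\mathrm{DW}}(p,\epsilon)$) if and only if for all $k\in\{1,\dots,n\}$ it holds that $$p_k>0\ \Longrightarrow\ p_m=0 \text{ for all } m\in\{k-\epsilon,\dots,k-2,\,k+2,\dots,k+\epsilon\}\cap\{1,\dots,n\}.$$
   Context: $\triangle^{n-1}=\{p\in\mathbb{R}^n_{\ge0} \mid \sum_{i=1}^n p_i=1\}$; its elements (opinion distributions) are treated as row vectors, and by convention $p_i=0$ for all integers $i\notin\{1,\dots,n\}$. The index set $\{k-\epsilon,\dots,k-2,k+2,\dots,k+\epsilon\}$ consists of the integers $m$ with $2\le|m-k|\le\epsilon$. Deffuant-Weisbuch transition matrix: for $p\in\triangle^{n-1}$ and $i\in\{1,\dots,n\}$ and an integer $m$, put $\pi^i_m:=p_m$ if $|i-m|\le\epsilon$ and $\pi^i_m:=0$ otherwise. Then $B^{\mathrm{DW}}(p,\epsilon)$ is the $n\times n$ matrix with $$B^{\mathrm{DW}}_{ij}(p,\epsilon)=\tfrac12\pi^i_{2j-i-1}+\pi^i_{2j-i}+\tfrac12\pi^i_{2j-i+1}\quad\text{if } i\ne j,$$ $$B^{\mathrm{DW}}_{ii}(p,\epsilon)=1-\sum_{j\ne i,\ j=1}^n B^{\mathrm{DW}}_{ij}(p,\epsilon).$$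 *)

(* Defs.v *)
From mathcomp Require Import all_boot all_order all_algebra.
From mathcomp Require Import reals.

Set Implicit Arguments.
Unset Strict Implicit.
Unset Printing Implicit Defensive.

Import Order.TTheory GRing.Theory Num.Theory.
Local Open Scope ring_scope.

Definition simplex (R : realType) (n : nat) (p : 'rV[R]_n) : Prop :=
  (forall i, 0 <= p 0 i) /\ \sum_i p 0 i = 1.

(* The opinion classes are numbered 1, ..., n while the elements of 'I_n are
   0, ..., n - 1; the number is an integer so that differences of class
   numbers are not truncated. *)
Definition label (n : nat) (i : 'I_n) : int := i.+1%:Z.

(* p_m for an arbitrary integer m: zero unless 1 <= m <= n. *)
Definition opinion (R : realType) (n : nat) (p : 'rV[R]_n) (m : int) : R :=
  if [pick k : 'I_n | label k == m] is Some k then p 0 k else 0.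

(* The truncated opinion usually written pi^i_m. *)
Definition confidence (R : realType) (n : nat) (p : 'rV[R]_n) (eps : nat)
    (i m : int) : R :=
  if `|i - m| <= eps%:Z then opinion p m else 0.

(* A pair in classes i and m meets at (i + m) / 2, rounded up or down with
   probability 1/2 when i + m is odd; only used for i != j. *)
Definition DW_offdiag (R : realType) (n : nat) (p : 'rV[R]_n) (eps : nat)
    (i j : 'I_n) : R :=
  let pi := confidence p eps (label i) in
  2^-1 * pi (2 * label j - label i - 1)
  + pi (2 * label j - label i)
  + 2^-1 * pi (2 * label j - label i + 1).

Definition DW (R : realType) (n : nat) (p : 'rV[R]_n) (eps : nat) : 'M[R]_n :=
  \matrix_(i, j)
    if i != j then DW_offdiag p eps i j
    else 1 - \sum_(k < n | k != i) DW_offdiag p eps i k.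

(* Main.v *)
Require Import Defs.
From mathcomp Require Import all_boot all_order all_algebra.
From mathcomp Require Import reals.
From mathcomp Require Import zify ring.

Import Order.TTheory GRing.Theory Num.Theory.
Local Open Scope ring_scope.

(* Summed against a test function f, one step of the chain changes p by half
   the sum, over meeting pairs (i, m) weighted by p_i p_m, of
   f(lo) + f(hi) - f(i) - f(m), where lo and hi are the two roundings of
   (i + m) / 2.  For the convex f(x) = x ^ 2 this is nonpositive, and negative
   once |i - m| >= 2, so a fixed point has no such meeting pair.  Conversely,
   if all meeting pairs satisfy |i - m| <= 1, then {lo, hi} = {i, m} and every
   f is preserved. *)

Lemma half_ord_subproof (n : nat) (i m : 'I_n) : ((i + m)./2 < n)%N.
Proof. by have := ltn_ord i; have := ltn_ord m; lia. Qed.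

Lemma uphalf_ord_subproof (n : nat) (i m : 'I_n) : (uphalf (i + m) < n)%N.
Proof. by have := ltn_ord i; have := ltn_ord m; lia. Qed.

(** Adding one to both indices adds one to their midpoint, so rounding the zero-based indices agrees
    with rounding the class numbers. *)
Definition half_ord (n : nat) (i m : 'I_n) := Ordinal (half_ord_subproof n i m).
Definition uphalf_ord (n : nat) (i m : 'I_n) :=
  Ordinal (uphalf_ord_subproof n i m).

Lemma half_ordC (n : nat) (i m : 'I_n) : half_ord n i m = half_ord n m i.
Proof. by apply: val_inj; rewrite /= addnC. Qed.

Lemma uphalf_ordC (n : nat) (i m : 'I_n) : uphalf_ord n i m = uphalf_ord n m i.
Proof. by apply: val_inj; rewrite /= addnC. Qed.

Lemma label_inj (n : nat) : injective (@label n).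
Proof. by move=> i j; rewrite /label => -[] /val_inj. Qed.

Section OneStep.
Variables (R : realType) (n : nat) (p : 'rV[R]_n) (eps : nat).

Lemma opinion_label (k : 'I_n) : opinion p (label k) = p 0 k.
Proof.
rewrite /opinion; case: pickP => [l /eqP /label_inj -> //|/(_ k)].
by rewrite eqxx.
Qed.

(** Gives the three terms of [DW_offdiag] a common summation over the partner class [m]; at an
    integer that labels no class both sides are zero. *)
Lemma confidence_sum (a x : int) :
  confidence p eps a x =
    \sum_(m < n) confidence p eps a (label m) * (label m == x)%:R.
Proof.
have [k /eqP <-|no_k] := pickP (fun k : 'I_n => label k == x).
  rewrite (bigD1 k) //= eqxx mulr1 big1 ?addr0 // => m m_neq_k.
  by rewrite (inj_eq (@label_inj n)) (negPf m_neq_k) mulr0.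
rewrite big1 => [|m _]; last by rewrite no_k mulr0.
by rewrite /confidence /opinion; case: pickP => [k|]; rewrite ?no_k ?if_same.
Qed.

(** Parity of [i + m] decides which terms survive: if odd, the two half-weighted ones, which select
    the two roundings; if even, only the middle one, and both roundings coincide with it. *)
Lemma DW_offdiagE (i j : 'I_n) :
  DW_offdiag p eps i j =
    2^-1 * \sum_m confidence p eps (label i) (label m) *
      ((j == half_ord n i m)%:R + (j == uphalf_ord n i m)%:R).
Proof.
rewrite /DW_offdiag !(confidence_sum (label i) (_ + _)).
rewrite !mulr_sumr -!big_split /=.
apply: eq_bigr => m _; set c := confidence _ _ _ _.
rewrite -!val_eqE /label /=.
have [odd_im|even_im] := boolP (odd (i + m)).
  have -> : (m.+1%:Z == 2 * j.+1%:Z - i.+1%:Z - 1) =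
      (j == uphalf (i + m) :> nat) by lia.
  have -> : (m.+1%:Z == 2 * j.+1%:Z - i.+1%:Z + 1) = (j == (i + m)./2 :> nat)
    by lia.
  have -> : (m.+1%:Z == 2 * j.+1%:Z - i.+1%:Z) = false by lia.
  by rewrite mulr0 addr0; ring.
have -> : (m.+1%:Z == 2 * j.+1%:Z - i.+1%:Z - 1) = false by lia.
have -> : (m.+1%:Z == 2 * j.+1%:Z - i.+1%:Z + 1) = false by lia.
have -> : (m.+1%:Z == 2 * j.+1%:Z - i.+1%:Z) = (j == (i + m)./2 :> nat) by lia.
have -> : uphalf (i + m) = (i + m)./2 by lia.
by rewrite !mulr0 addr0 add0r; field.
Qed.

Definition meeting (i m : 'I_n) : R :=
  p 0 i * confidence p eps (label i) (label m).

Lemma meetingE (i m : 'I_n) :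
  meeting i m = if `|label i - label m| <= eps%:Z then p 0 i * p 0 m else 0.
Proof.
by rewrite /meeting /confidence opinion_label; case: ifP; rewrite ?mulr0.
Qed.

Lemma meetingC (i m : 'I_n) : meeting i m = meeting m i.
Proof. by rewrite !meetingE distrC mulrC. Qed.

(** The diagonal entry makes row [i] sum to one. The factor [f j - f i] vanishes at [j = i], so the
    off-diagonal formula can be summed over every [j]. *)
Lemma DW_test (f : 'I_n -> R) (i : 'I_n) :
  \sum_j DW p eps i j * f j =
    f i + \sum_j DW_offdiag p eps i j * (f j - f i).
Proof.
rewrite (bigD1 i) //= [in RHS](bigD1 i) //= subrr mulr0 add0r.
rewrite mxE eqxx /= mulrBl mul1r mulr_suml -addrA; congr (_ + _).
rewrite addrC -sumrB; apply: eq_bigr => j j_neq_i.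
by rewrite mxE eq_sym j_neq_i mulrBr.
Qed.

Lemma sum_offdiag (f : 'I_n -> R) (i : 'I_n) :
  \sum_j DW_offdiag p eps i j * f j =
    2^-1 * \sum_m confidence p eps (label i) (label m) *
      (f (half_ord n i m) + f (uphalf_ord n i m)).
Proof.
under eq_bigr => j _ do rewrite DW_offdiagE -mulrA mulr_suml.
rewrite -mulr_sumr exchange_big /=; congr (_ * _); apply: eq_bigr => m _.
under eq_bigr => j _ do rewrite -mulrA mulrDl !mulr_natl !mulrb.
by rewrite -mulr_sumr big_split /= -!big_mkcond /= !big_pred1_eq.
Qed.

Lemma step_test (f : 'I_n -> R) :
  2 * (\sum_j (p *m DW p eps) 0 j * f j - \sum_j p 0 j * f j) =
    \sum_i \sum_m meeting i m *
      (f (half_ord n i m) + f (uphalf_ord n i m) - f i - f m).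
Proof.
pose g i m :=
  meeting i m * (f (half_ord n i m) + f (uphalf_ord n i m) - 2 * f i).
have -> : \sum_j (p *m DW p eps) 0 j * f j - \sum_j p 0 j * f j =
    2^-1 * \sum_i \sum_m g i m.
  under eq_bigr => j _ do rewrite mxE mulr_suml.
  rewrite exchange_big /= -sumrB mulr_sumr; apply: eq_bigr => i _.
  under eq_bigr => j _ do rewrite -mulrA.
  rewrite -mulr_sumr DW_test (sum_offdiag (fun j => f j - f i)).
  rewrite mulrDr addrAC subrr add0r mulrCA mulr_sumr; congr (_ * _).
  by apply: eq_bigr => m _; rewrite /g /meeting; ring.
(* Averaging with the sum in which [i] and [m] are swapped turns [2 * f i] into [f i + f m], since
   [meeting] and both roundings are symmetric. *)
transitivity (2^-1 * (\sum_i \sum_m g i m + \sum_i \sum_m g i m)).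
  by field.
rewrite [X in _ + X]exchange_big -!big_split mulr_sumr /=.
apply: eq_bigr => i _; rewrite -big_split mulr_sumr /=; apply: eq_bigr => m _.
by rewrite /g (meetingC m) (half_ordC _ m) (uphalf_ordC _ m); field.
Qed.
End OneStep.

(** With [m = i + a + b], where [a] and [b] are the two halves of the gap, the roundings are [i + a]
    and [i + b], and the squares differ by [2ab]. This is positive once the gap is at least 2. *)
Lemma half_sqrsD (i m : nat) : (i <= m)%N ->
  (i ^ 2 + m ^ 2 = (i + m)./2 ^ 2 + uphalf (i + m) ^ 2
     + 2 * ((m - i)./2 * uphalf (m - i)))%N.
Proof.
move=> /subnKC; move: (m - i)%N => d <-.
have -> : (i + (i + d))./2 = (i + d./2)%N by lia.
have -> : uphalf (i + (i + d)) = (i + uphalf d)%N by lia.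
have {1}-> : d = (d./2 + uphalf d)%N by lia.
move: d./2 (uphalf d) => a b; ring.
Qed.

Lemma half_sqr_le (i m : nat) :
  ((i + m)./2 ^ 2 + uphalf (i + m) ^ 2 <= i ^ 2 + m ^ 2)%N.
Proof.
wlog le_im : i m / (i <= m)%N => [ih|]; last first.
  by rewrite (half_sqrsD _ _ le_im) leq_addr.
have [/ih //|/ltnW/ih] := leqP i m.
by rewrite (addnC m i) (addnC (m ^ 2)%N).
Qed.

Lemma half_sqr_lt (i m : nat) : (i.+2 <= m)%N || (m.+2 <= i)%N ->
  ((i + m)./2 ^ 2 + uphalf (i + m) ^ 2 < i ^ 2 + m ^ 2)%N.
Proof.
wlog le_im : i m / (i <= m)%N => [ih far|far].
  have [/ih -> //|/ltnW/ih] := leqP i m.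
  by rewrite (addnC m i) (addnC (m ^ 2)%N) orbC; apply.
by rewrite (half_sqrsD _ _ le_im) -[ltnLHS]addn0 ltn_add2l !muln_gt0 /=; lia.
Qed.

Lemma half_uphalf_adjacent (T : zmodType) (n : nat) (f : 'I_n -> T)
    (i m : 'I_n) : (m <= i.+1)%N -> (i <= m.+1)%N ->
  f (half_ord n i m) + f (uphalf_ord n i m) - f i - f m = 0.
Proof.
move=> mi im; have [le_im|lt_mi] := leqP i m.
  have -> : half_ord n i m = i by apply: val_inj => /=; lia.
  have -> : uphalf_ord n i m = m by apply: val_inj => /=; lia.
  by rewrite addrAC addrK subrr.
have -> : half_ord n i m = m by apply: val_inj => /=; lia.
have -> : uphalf_ord n i m = i by apply: val_inj => /=; lia.
by rewrite addrK subrr.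
Qed.

Theorem theorem3 (R : realType) (n eps : nat) (hn : (0 < n)%N)
    (heps : (0 < eps)%N) (p : 'rV[R]_n) (hp : simplex p) :
  p = p *m DW p eps <->
  (forall k : 'I_n, 0 < p 0 k ->
     forall m : 'I_n, 2 <= `|label m - label k| <= eps%:Z -> p 0 m = 0).
Proof.
have [p_ge0 _] := hp.
split=> [fix_p k p_k m /andP[far_mk near_mk]|no_meeting].
  pose f (j : 'I_n) : R := (j ^ 2)%:R.
  pose loss i j := meeting R n p eps i j *
    (f i + f j - f (half_ord n i j) - f (uphalf_ord n i j)).
  have loss_ge0 i j : 0 <= loss i j.
    apply: mulr_ge0; first by rewrite meetingE; case: ifP; rewrite ?mulr_ge0.
    by rewrite -addrA -opprD subr_ge0 -!natrD ler_nat half_sqr_le.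
  have loss0 : \sum_i \sum_j loss i j = 0.
    have := step_test R n p eps f; rewrite -fix_p subrr mulr0 => step0.
    apply: oppr_inj; rewrite oppr0; apply: etrans (esym step0).
    rewrite -sumrN; apply: eq_bigr => i _.
    by rewrite -sumrN; apply: eq_bigr => j _; rewrite /loss; ring.
  have loss_k : \sum_j loss k j = 0.
    by apply: (psumr_eq0P _ loss0) => // i _; apply: sumr_ge0.
  move/eqP: (psumr_eq0P (fun j _ => loss_ge0 k j) loss_k (i := m) isT).
  (* As [p 0 k] is positive, a vanishing loss leaves [p 0 m = 0] or equality in the inequality of
     squares; the distance between [k] and [m] rules out the latter. *)
  rewrite mulf_eq0 meetingE distrC near_mk mulf_eq0 gt_eqF //=.
  case/orP=> [/eqP //|].
  rewrite -addrA -opprD subr_eq0 -!natrD eqr_nat gtn_eqF //.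
  apply: half_sqr_lt; move: far_mk; rewrite /label; lia.
have test (f : 'I_n -> R) :
    \sum_j (p *m DW p eps) 0 j * f j = \sum_j p 0 j * f j.
  have two0 : (2 : R) != 0 by rewrite pnatr_eq0.
  apply/eqP; rewrite -subr_eq0 -(inj_eq (mulfI two0)) mulr0 step_test.
  apply/eqP; apply: big1 => i _; apply: big1 => m _.
  rewrite meetingE; case: ifP => [near_im|]; last by rewrite mul0r.
  have [|far_im] := boolP ((m <= i.+1)%N && (i <= m.+1)%N).
    by case/andP=> mi im; rewrite half_uphalf_adjacent ?mulr0.
  (* A meeting pair at distance at least 2 has weight zero: either [p 0 i = 0], or the hypothesis at
     [i] forces [p 0 m = 0]. *)
  have := p_ge0 i; rewrite le_eqVlt => /orP[/eqP <-|p_i].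
    by rewrite !mul0r.
  rewrite (no_meeting i p_i m) ?mulr0 ?mul0r // distrC near_im andbT.
  by move: far_im; rewrite /label; lia.
(* The indicator of [j] as test function recovers the [j]-th entry. *)
apply/rowP => j; have := test (fun i => (i == j)%:R).
under eq_bigr => i _ do rewrite mulr_natr mulrb.
under [in RHS]eq_bigr => i _ do rewrite mulr_natr mulrb.
by rewrite -!big_mkcond /= !big_pred1_eq.
Qed.
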